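(* Let $X=(x_n)_{n\ge1}$ be a sequence of positive real numbers such that for every $\varepsilon>0$, for all sufficiently large $n$, $$x_{n+1}>\Big(1+\frac{1}{n^{\varepsilon}}\Big)x_n.$$ Then for almost every $\alpha\in\mathbb{R}$, $$\delta_{\min}^{\alpha}(N)<\frac{1}{N^{2-o(1)}},$$ where the rate of decay of the $o(1)$ term depends on $\alpha$.
   Context: For $x\in\mathbb{R}$, $\|x\|=\min_{k\in\mathbb{Z}}|x-k|$. For $\alpha\in\mathbb{R}$, $\delta_{\min}^{\alpha}(N)=\min\{\|\alpha x_m-\alpha x_n\| : 1\le m,n\le N,\ m\ne n\}$. The notation $\frac{1}{N^{2-o(1)}}$ means $N^{-(2-f_\alpha(N))}$ for some function $f_\alpha(N)\to0$ as $N\to\infty$, the inequality holding for all sufficiently large $N$. *)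

(* Defs.v *)
From HB Require Import structures.
From mathcomp Require Import all_boot all_order all_algebra.
From mathcomp Require Import all_classical all_reals all_analysis.
Set Implicit Arguments. Unset Strict Implicit. Unset Printing Implicit Defensive.
Import Order.TTheory GRing.Theory Num.Theory.
Import numFieldNormedType.Exports.
Local Open Scope classical_set_scope.
Local Open Scope ring_scope.

(* ||y|| = min_{k in Z} |y - k|  (the minimum exists; written as inf) *)
Definition distZ {R : realType} (y : R) : R :=
  inf (range (fun k : int => `|y - k%:~R|)).

(* delta_min^alpha(N) = min { ||alpha x_m - alpha x_n|| : 1 <= m,n <= N, m <> n }
   (finite set, nonempty for N >= 2; written as inf) *)
Definition delta_min {R : realType} (x : nat -> R) (alpha : R) (N : nat) : R :=
  inf [set distZ (alpha * x mn.1 - alpha * x mn.2) | mn in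
         [set mn : nat * nat | [/\ (1 <= mn.1 <= N)%N, (1 <= mn.2 <= N)%N & mn.1 != mn.2]]].

(* Main.v *)
(* Fix eta and let delta = N^(-(2 - eta)).  Choosing every K-th term with K = N^(eta/4 + o(1)),
   one obtains 2H = N^(1 - eta/4 - o(1)) terms y_0 < y_1 < ... of x up to index N whose
   consecutive ratios exceed any power of N.  On an interval of length 1/y_k (k >= H) the
   numbers alpha y_j, j < H, are almost constant, whereas alpha y_k runs once around R/Z; if
   the alpha y_j are delta-separated, keeping alpha y_k away from them excludes a proportion of
   about H delta / 2 of the interval.  Iterating over H <= k < 2H, the alpha in a bounded
   interval for which all N points are delta-separated have measure
   O((1 - H delta / 4)^H) = O(exp (- H^2 delta / 4)) = O(N^-2), and Borel-Cantelli applies.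
   A diagonal argument over eta = 1/(q+1) produces the o(1) term. *)
Require Import Defs.
From HB Require Import structures.
From mathcomp Require Import all_boot all_order all_algebra.
From mathcomp Require Import all_classical all_reals all_analysis.
From mathcomp Require Import measurable_realfun.
From mathcomp Require Import ring lra zify.
Import Order.TTheory GRing.Theory Num.Theory.
Import numFieldNormedType.Exports.
Local Open Scope classical_set_scope.
Local Open Scope ring_scope.

(** * Lebesgue measure of a set on half-open intervals *)

(** Real-valued, so that bounds become linear arithmetic; for measurable [E] nothing is lost, as
    bounded intervals have finite measure. *)
Definition mass {R : realType} (E : set R) (a b : R) : R :=
  fine (@lebesgue_measure R (E `&` `[a, b[)).

Lemma mass_le_length (R : realType) (E : set R) (a b : R) :
  measurable E -> a <= b ->
  (@lebesgue_measure R (E `&` `[a, b[) <= (b - a)%:E)%E.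
Proof.
move=> mE ab.
apply: (@le_trans _ _ (@lebesgue_measure R `[a, b[)).
  apply: le_measure => //; rewrite inE; first by apply: measurableI.
  exact: measurable_itv.
rewrite lebesgue_measure_itv /= lte_fin; case: ifP => // _.
by rewrite lee_fin subr_ge0.
Qed.

Lemma mass_fineK (R : realType) (E : set R) (a b : R) :
  measurable E -> (mass E a b)%:E = @lebesgue_measure R (E `&` `[a, b[).
Proof.
move=> mE; rewrite /mass fineK // ge0_fin_numE //.
apply: (@le_lt_trans _ _ (Num.max a b - a)%:E); last exact: ltry.
apply: le_trans (mass_le_length R E a (Num.max a b) mE _); last by rewrite le_max lexx.
apply: le_measure; rewrite ?inE; try exact: measurableI.
apply: setIS => t /=; rewrite !in_itv /= => /andP[-> tb].
by rewrite lt_max tb orbT.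
Qed.

Lemma mass_length (R : realType) (E : set R) (a b : R) :
  measurable E -> a <= b -> mass E a b <= b - a.
Proof. by move=> mE ab; rewrite -lee_fin mass_fineK //; exact: mass_le_length. Qed.

Lemma mass_split (R : realType) (E : set R) (a b c : R) :
  measurable E -> mass E a b <= mass E a c + mass E c b.
Proof.
move=> mE; rewrite -lee_fin EFinD !mass_fineK //.
apply: le_trans (measureU2 _ _ _); try exact: measurableI.
apply: le_measure; rewrite ?inE.
- exact: measurableI.
- by apply: measurableU; exact: measurableI.
move=> t [Et] /=; rewrite !in_itv /= => /andP[-> ->].
by have [tc|ct] := ltP t c; [left|right]; split => //=; rewrite in_itv /= ?tc ?ct // andbT.
Qed.

Lemma mass_eq0 (R : realType) (E : set R) (a b : R) :
  (forall t, a <= t < b -> ~ E t) -> mass E a b = 0.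
Proof.
move=> H; rewrite /mass (_ : _ `&` _ = set0) ?measure0 //.
by apply/seteqP; split => // t [Et] /=; rewrite in_itv /= => /H.
Qed.

Lemma mass_mono (R : realType) (E : set R) (a b b' : R) :
  measurable E -> b <= b' -> mass E a b <= mass E a b'.
Proof.
move=> mE bb; rewrite -lee_fin !mass_fineK //.
apply: le_measure; rewrite ?inE; try exact: measurableI.
apply: setIS => t /=; rewrite !in_itv /= => /andP[-> tb] /=.
exact: lt_le_trans bb.
Qed.

(** * Measure lost in one period, and its iteration over scales *)

(** The gaps of length [h] cut [a, b[ into at most [size s + 1] pieces, each paying [c * e] on top
    of [c] times its length. Starting the path at [a - h] puts the first gap at or after [a]; the
    last gap may overhang [b], hence the total length [b + h - a]. *)
Lemma mass_gaps (R : realType) (E : set R) (c e h : R) (s : seq R) (a b : R) :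
  measurable E -> 0 <= c -> 0 <= e -> 0 <= h ->
  (forall u v, u <= v -> mass E u v <= c * (v - u + e)) ->
  path (fun u v => u + h <= v) (a - h) s -> all (fun u => u < b) s ->
  (forall u, u \in s -> mass E u (u + h) = 0) ->
  a <= b + h ->
  mass E a b <= c * (b + h - a - (size s)%:R * h + (size s)%:R * e + e).
Proof.
move=> mE c0 e0 h0 bnd.
elim: s a => [|u s IH] a /=.
  move=> _ _ _ abh; rewrite !mul0r subr0 addr0.
  (* The case [b < a] arises when the last gap overhangs [b]; the mass is then zero. *)
  have [ab|ba] := leP a b.
    apply: (le_trans (bnd a b ab)); apply: ler_wpM2l => //; lra.
  rewrite mass_eq0 => [|t /andP[at_ tb]]; last by lra.
  by apply: mulr_ge0 => //; lra.
rewrite subrK => /andP[au pus] /andP[ub sb] s0 abh.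
have IHu : mass E (u + h) b <= c * (b + h - (u + h) - (size s)%:R * h + (size s)%:R * e + e).
  apply: IH => //; first by rewrite addrK.
    by move=> v vs; apply: s0; rewrite inE vs orbT.
  by lra.
have H1 := bnd a u au.
have H2 : mass E u (u + h) = 0 by apply: s0; rewrite mem_head.
have H3 := mass_split R E a b u mE.
have H4 := mass_split R E u b (u + h) mE.
apply: (@le_trans _ _ (c * (u - a + e) + c * (b + h - (u + h) - (size s)%:R * h + (size s)%:R * e + e))).
  lra.
rewrite -mulrDr ler_wpM2l // -[(size s).+1]addn1 natrD; lra.
Qed.

(* E misses [c_j, c_j + delta / (2 Y)) for each j < H, where Y c_j = y_j t mod 1 for
   some t in E within the period.  The last of these intervals may stick out of the period,
   which costs the term delta / (2 Y). *)
Lemma mass_period (R : realType) (E : set R) (H : nat) (y : nat -> R) (Y delta c e p : R) :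
  measurable E -> 0 < Y -> 0 < delta -> H%:R * delta <= 2 ->
  (forall j, (j < H)%N -> 0 <= y j <= delta / 4 * Y) ->
  (forall t, E t -> forall i j, (i < H)%N -> (j < H)%N -> i != j -> forall z : int,
     delta <= `|t * (y j - y i) - z%:~R|) ->
  (forall t, E t -> forall j, (j < H)%N -> forall z : int,
     delta <= `|t * (Y - y j) - z%:~R|) ->
  0 <= c -> 0 <= e ->
  (forall u v, u <= v -> mass E u v <= c * (v - u + e)) ->
  mass E p (p + Y^-1) <=
  c * (Y^-1 + delta / 2 / Y - H%:R * (delta / 2 / Y) + H%:R * e + e).
Proof.
move=> mE Y0 d0 Hd yY sepy sepY c0 e0 bnd.
set h := delta / 2 / Y.
have Yi0 : 0 < Y^-1 by rewrite invr_gt0.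
have h0 : 0 < h by rewrite /h !divr_gt0.
have HhY : H%:R * h <= Y^-1.
  rewrite /h mulrA -[leRHS]mul1r ler_pM2r //; lra.
(* One point [t] of [E] in the period serves as reference: the values y_j t stand in for y_j alpha
   throughout the period. *)
have [[t [/andP[pt tp] Et]]|noE] := pselect (exists t, p <= t < p + Y^-1 /\ E t); last first.
  rewrite mass_eq0 => [|t tp Et]; last by apply: noE; exists t.
  apply: mulr_ge0 => //.
  have : 0 <= H%:R * e by rewrite mulr_ge0.
  lra.
pose u j := y j * t - p * Y.
(* The point of the period at which Y alpha agrees with y_j t modulo 1. *)
pose ctr j := p + (u j - (Num.floor (u j))%:~R) / Y.
have YE j : Y * ctr j = y j * t - (Num.floor (u j))%:~R.
  by rewrite /ctr /u; field; exact: lt0r_neq0.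
have ctr_itv j : p <= ctr j < p + Y^-1.
  have /andP[f1 f2] := floor_itv (u j).
  rewrite intrD in f2.
  rewrite /ctr lerDl ltrD2l -[ltRHS]mul1r ltr_pM2r // mulr_ge0 ?subr_ge0 //=; [lra|exact: ltW].
(* Separation at [t] keeps the centres delta / Y apart; only half of this is used as [h], the other
   half absorbing the drift of y_j alpha. *)
have ctr_gap i j : (i < H)%N -> (j < H)%N -> i != j -> h <= `|ctr j - ctr i|.
  move=> iH jH ij.
  have := sepy t Et i j iH jH ij (Num.floor (u j) - Num.floor (u i)).
  rewrite (_ : _ - _ = Y * (ctr j - ctr i)); last by rewrite [in RHS]mulrBr !YE intrD intrN; ring.
  rewrite normrM (gtr0_norm Y0) -ler_pdivrMl // => hh.
  apply: le_trans hh; rewrite /h mulrC ler_pM2l //; lra.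
have ctr_empty j : (j < H)%N -> mass E (ctr j) (ctr j + h) = 0.
  move=> jH; apply: mass_eq0 => al /andP[al1 al2] Eal.
  have := sepY al Eal j jH (- Num.floor (u j)).
  apply/negP; rewrite -ltNge intrN opprK.
  have /andP[cp1 cp2] := ctr_itv j.
  have hY : h <= Y^-1.
    apply: le_trans HhY; rewrite -[leLHS]mul1r ler_pM2r // ler1n.
    by case: (H) jH.
  (* The first summand lies in [0, delta / 2[. The second is at most delta / 2 in size, since [al]
     and [t] both lie in [p, p + 2 / Y[ and y_j is at most delta Y / 4. *)
  have -> : al * (Y - y j) + (Num.floor (u j))%:~R = Y * (al - ctr j) + y j * (t - al).
    by rewrite [Y * (_ - _)]mulrBr YE; ring.
  have E1 : 0 <= Y * (al - ctr j) < delta / 2.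
    rewrite mulr_ge0 ?subr_ge0 ?(ltW Y0) //= mulrC -ltr_pdivlMr // -/h; lra.
  have E2 : `|y j * (t - al)| <= delta / 2.
    have /andP[y0 y1] := yY j jH.
    rewrite normrM (ger0_norm y0).
    apply: (@le_trans _ _ ((delta / 4 * Y) * (2 * Y^-1))).
      apply: ler_pM => //; rewrite ler_norml; apply/andP; split; lra.
    rewrite le_eqVlt; apply/orP; left; apply/eqP; field; exact: lt0r_neq0.
  case/andP: E1 => E1 E1'; move: E2; rewrite ler_norml => /andP[E2 E2'].
  rewrite ltr_norml; apply/andP; split; lra.
pose s0 := [seq ctr j | j <- iota 0 H].
have us0 : uniq s0.
  rewrite map_inj_in_uniq ?iota_uniq // => i j.
  rewrite !mem_iota /= add0n => iH jH eqij.
  apply/eqP; case: (eqVneq i j) => // nij.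
  have := ctr_gap i j iH jH nij; rewrite eqij subrr normr0; lra.
pose s := sort <=%O s0.
have ins z : z \in s -> exists2 j, (j < H)%N & z = ctr j.
  by rewrite mem_sort => /mapP[j]; rewrite mem_iota /= => jH ->; exists j.
have ss : sorted (fun u v => u + h <= v) s.
  apply: (@sub_in_sorted _ (mem s) <%O); last 2 first.
  - by apply/allP.
  - by rewrite lt_sorted_uniq_le sort_uniq us0 sort_le_sorted.
  move=> v w /ins[i iH ->] /ins[j jH ->] lt.
  have ij : i != j by apply: contraTneq lt => ->; rewrite ltxx.
  have := ctr_gap i j iH jH ij; rewrite gtr0_norm ?subr_gt0 //; lra.
have szs : size s = H by rewrite size_sort size_map size_iota.
have := @mass_gaps R E c e h s p (p + Y^-1) mE c0 e0 (ltW h0) bnd.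
rewrite szs (_ : p + Y^-1 + h - p = Y^-1 + h); last by ring.
apply.
- case: (s) ins ss => //= v r insr ->; rewrite andbT subrK.
  by have [j _ ->] := insr v (mem_head _ _); have /andP[] := ctr_itv j.
- by apply/allP => v /ins[j _ ->]; have /andP[] := ctr_itv j.
- by move=> v /ins[j jH ->]; exact: ctr_empty.
- lra.
Qed.

(** At most (b - a) Y + 1 consecutive periods starting at [a] cover [a, b[. *)
Lemma mass_periods (R : realType) (E : set R) (Y B a b : R) :
  measurable E -> 0 < Y -> 0 <= B -> a <= b ->
  (forall p, mass E p (p + Y^-1) <= B) ->
  mass E a b <= ((b - a) * Y + 1) * B.
Proof.
move=> mE Y0 B0 ab HB.
have multi n : mass E a (a + n%:R * Y^-1) <= n%:R * B.
  elim: n => [|n IH].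
    by rewrite !mul0r addr0 mass_eq0 // => t /andP[? ?]; lra.
  apply: (le_trans (mass_split _ _ _ _ (a + n%:R * Y^-1) mE)).
  rewrite -natr1 [_ * B]mulrDl mul1r lerD //.
  by rewrite mulrDl mul1r addrA; exact: HB.
have q0 : 0 <= (b - a) * Y by rewrite mulr_ge0 ?subr_ge0 // ltW.
pose n := (Num.truncn ((b - a) * Y)).+1.
have n1 : (b - a) * Y < n%:R by exact: truncnS_gt.
have n2 : n%:R <= (b - a) * Y + 1.
  by rewrite /n -natr1 lerD2r; rewrite truncn_le.
apply: (@le_trans _ _ (mass E a (a + n%:R * Y^-1))).
  apply: mass_mono => //; rewrite -lerBlDl -ler_pdivrMr ?invr_gt0 // invrK; exact: ltW.
by apply: le_trans (multi n) _; exact: ler_wpM2r.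
Qed.

(** Induction from the finest scale down: the bound at scale y_(k+1) is the hypothesis of
    [mass_period] at scale Y = y_k, with e = 1 / y_(k+1). Summing over the (b - a) Y + 1 periods
    turns the extra period into the new error term 1 / Y, so the shape of the bound is preserved. *)
Lemma mass_decay (R : realType) (E : set R) (H : nat) (y : nat -> R) (delta : R) :
  measurable E -> (3 <= H)%N -> 0 < delta -> H%:R * delta <= 2 ->
  (forall i, (i <= 2 * H)%N -> 0 < y i) ->
  (forall i, (i < 2 * H)%N -> 4 * (H.+1)%:R / delta * y i <= y i.+1) ->
  (forall t, E t -> forall i j, (i < 2 * H)%N -> (j < 2 * H)%N -> i != j ->
     forall z : int, delta <= `|t * (y j - y i) - z%:~R|) ->
  forall m, (m <= H)%N -> forall a b, a <= b ->
  mass E a b <= (1 - H%:R * delta / 4) ^+ m * (b - a + (y (2 * H - m)%N)^-1).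
Proof.
move=> mE H3 d0 Hd y0 yg sep; elim=> [|m IH] mH a b ab.
  rewrite expr0 mul1r subn0.
  apply: le_trans (mass_length _ _ _ _ mE ab) _.
  by rewrite lerDl invr_ge0 ltW // y0.
set w := H%:R * delta / 4 in IH *.
have H3R : 3 <= H%:R :> R by rewrite (ler_nat _ 3).
have w1 : 0 <= 1 - w by rewrite /w; lra.
set c := (1 - w) ^+ m in IH *.
have c0 : 0 <= c by exact: exprn_ge0.
pose k := (2 * H - m.+1)%N.
have kS : (2 * H - m = k.+1)%N by rewrite /k; lia.
have kH : (H <= k)%N by rewrite /k; lia.
have k2H : (k < 2 * H)%N by rewrite /k; lia.
rewrite -/k; rewrite kS in IH.
have Y0 : 0 < y k by exact: y0 (ltnW k2H).
have Y10 : 0 < y k.+1 by exact: y0.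
set Y := y k in Y0 *; set e := (y k.+1)^-1.
have e0 : 0 < e by rewrite invr_gt0.
have C1 : 4 / delta <= 4 * (H.+1)%:R / delta.
  rewrite ler_pM2r ?invr_gt0 // -natr1; lra.
have d2 : delta <= 2 by apply: le_trans Hd; rewrite ler_peMl ?(ltW d0) //; lra.
have Cge1 : 1 <= 4 * (H.+1)%:R / delta.
  apply: le_trans C1; rewrite ler_pdivlMr //; lra.
have ymono i j : (i <= j)%N -> (j <= 2 * H)%N -> y i <= y j.
  elim: j => [|j IHj]; first by rewrite leqn0 => /eqP ->.
  rewrite leq_eqVlt => /predU1P[-> //|ij] jH.
  have yj := IHj ij (ltnW jH).
  apply: (le_trans yj); apply: (le_trans _ (yg j jH)).
  by rewrite ler_peMl // ltW // y0 // ltnW.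
have yY j : (j < H)%N -> 0 <= y j <= delta / 4 * Y.
  move=> jH; have jk : (j < k)%N by exact: leq_trans kH.
  have j2H : (j < 2 * H)%N by exact: ltn_trans k2H.
  have yj0 : 0 < y j by exact: y0 (ltnW j2H).
  rewrite ltW //=.
  have h1 : 4 / delta * y j <= Y.
    apply: (@le_trans _ _ (4 * (H.+1)%:R / delta * y j)).
      by rewrite ler_pM2r.
    by apply: (le_trans (yg j j2H)); apply: ymono; last exact: ltnW.
  have -> : y j = delta / 4 * (4 / delta * y j) by field; exact: lt0r_neq0.
  by rewrite ler_pM2l // divr_gt0.
(* The growth factor 4 (H + 1) / delta is chosen so that the H + 1 error terms together cost at most
   delta / (4 Y). *)
have eY : (H.+1)%:R * e <= delta / 4 / Y.
  have := yg k k2H; rewrite -/Y => h1.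
  have Hn0 : 0 < (H.+1)%:R :> R by rewrite ltr0n.
  rewrite /e -ler_pdivlMl // -lef_pV2 ?posrE ?invr_gt0 // ?mulr_gt0 ?invr_gt0 ?divr_gt0 //.
  rewrite invrK; apply: le_trans h1.
  rewrite le_eqVlt; apply/orP; left; apply/eqP; field.
  by rewrite !lt0r_neq0 //= addrC natr1.
have base p : mass E p (p + Y^-1) <= c * (1 - w) / Y.
  apply: (le_trans (@mass_period R E H y Y delta c e p mE Y0 d0 Hd yY _ _ c0 (ltW e0) _)).
  - by move=> t Et i j iH jH ij z; apply: sep => //; apply: ltn_trans k2H; exact: leq_trans kH.
  - move=> t Et j jH z; have jk := leq_trans jH kH.
    by apply: sep => //; [exact: ltn_trans k2H|rewrite ltn_eqF].
  - by move=> u v uv; apply: IH => //; exact: ltnW.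
  rewrite -[leRHS]mulrA; apply: ler_wpM2l => //.
  rewrite -addrA -{2}[e]mul1r -mulrDl natr1.
  apply: (@le_trans _ _ (Y^-1 + delta / 2 / Y - H%:R * (delta / 2 / Y) + delta / 4 / Y)).
    by rewrite lerD2l.
  have -> : Y^-1 + delta / 2 / Y - H%:R * (delta / 2 / Y) + delta / 4 / Y
    = (1 + delta / 2 - H%:R * delta / 2 + delta / 4) / Y by ring.
  rewrite ler_pM2r ?invr_gt0 // /w.
  (* Of the gain H delta / 2, the overhang delta / 2 and the errors delta / 4 use up at most H delta
     / 4, because H is at least 3. *)
  have : 3 * delta <= H%:R * delta by rewrite ler_pM2r.
  lra.
apply: (le_trans (mass_periods _ _ _ _ _ _ mE Y0 _ ab base)).
  by rewrite divr_ge0 ?mulr_ge0 // ltW.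
rewrite exprSr -/c le_eqVlt; apply/orP; left; apply/eqP; field; exact: lt0r_neq0.
Qed.

(** * The set of alpha with separated points *)

(** Quantifying over all integers [z] instead of using [distZ] exhibits the set as an intersection
    of closed sets. *)
Definition separated_set {R : realType} (x : nat -> R) (N : nat) (delta : R) : set R :=
  [set t | forall m n, (1 <= m <= N)%N -> (1 <= n <= N)%N -> m != n ->
     forall z : int, delta <= `|t * (x m - x n) - z%:~R|].

Lemma measurable_separated_set (R : realType) (x : nat -> R) N delta :
  measurable (separated_set x N delta).
Proof.
apply: closed_measurable.
have -> : separated_set x N delta =
  \bigcap_(p in [set p : nat * nat * int | (1 <= p.1.1 <= N)%N /\ (1 <= p.1.2 <= N)%N /\ p.1.1 != p.1.2])
    ((fun t : R => `|t * (x p.1.1 - x p.1.2) - p.2%:~R|) @^-1` [set r | delta <= r]).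
  apply/seteqP; split => t /=.
    by move=> H [[m n] z] /= [? [? ?]]; apply: H.
  by move=> H m n hm hn mn z; exact: (H (m, n, z)).
apply: closed_bigI => -[[m n] z] _ /=.
apply: preimage_closed; last exact: closed_ge.
move=> t _ /=; apply: (@cvg_norm _ R); apply: cvgB; last exact: cvg_cst.
by apply: cvgM; [exact: cvg_id|exact: cvg_cst].
Qed.

Lemma delta_min_lt (R : realType) (x : nat -> R) (alpha delta : R) N :
  ~ separated_set x N delta alpha -> delta_min x alpha N < delta.
Proof.
have dist_lb (v : R) : has_lbound (range (fun k : int => `|v - k%:~R|)).
  by exists 0 => _ [k _ <-].
have dist_ge0 (v : R) : 0 <= distZ v.
  apply: lb_le_inf; last by move=> _ [k _ <-].
  by exists `|v - 0%:~R|, 0.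
apply: contra_notP => /negP; rewrite -leNgt => dle m n hm hn mn z.
apply: (le_trans dle).
apply: (@le_trans _ _ (distZ (alpha * x m - alpha * x n))).
  apply: ge_inf; last by exists (m, n).
  by exists 0 => _ [p _ <-].
rewrite mulrBr; apply: ge_inf => //; by exists z.
Qed.

(** * Growth estimates and the choice of parameters *)

Lemma geometric_growth (R : realType) (x : nat -> R) (r : R) (m K : nat) :
  0 <= r -> (forall n, (m <= n < m + K)%N -> r * x n <= x n.+1) ->
  r ^+ K * x m <= x (m + K)%N.
Proof.
move=> r0; elim: K => [|K IH] g; first by rewrite expr0 mul1r addn0.
rewrite exprS -mulrA addnS; apply: le_trans (g (m + K)%N _); last first.
  by rewrite leq_addr addnS ltnSn.
apply: ler_wpM2l => //; apply: IH => n /andP[mn nk]; apply: g.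
by rewrite mn addnS ltnS ltnW.
Qed.

Lemma powR_nat_eventually_ge (R : realType) (c e : R) : 0 < e ->
  \forall N \near \oo, c <= (N%:R : R) `^ e.
Proof.
move=> e0; have [c0|c0] := leP c 0.
  by apply: nearW => N; exact: le_trans c0 (powR_ge0 _ _).
have -> : c = (c `^ e^-1) `^ e by rewrite -powRrM mulVf ?powRr1 ?lt0r_neq0 // ltW.
near=> N; apply: ge0_ler_powR; rewrite ?nnegrE ?powR_ge0 //; first exact: ltW.
near: N; exact: nbhs_infty_ger.
Unshelve. all: by end_near. Qed.

(** Write N^e = v * v with v = N^(e/2): one factor dominates ln v = (e/2) ln N, the other the
    remaining constant. *)
Lemma ln_nat_eventually_le (R : realType) (c e : R) : 0 < e -> 0 <= c ->
  \forall N \near \oo, c * ln (N%:R : R) <= (N%:R : R) `^ e.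
Proof.
move=> e0 c0; have e20 : 0 < e / 2 by rewrite divr_gt0.
near=> N.
have N0 : 0 < N%:R :> R by rewrite ltr0n; near: N; exact: nbhs_infty_gt.
set v := (N%:R : R) `^ (e / 2).
have v0 : 0 < v by exact: powR_gt0.
have -> : (N%:R : R) `^ e = v * v.
  by rewrite /v -powRD -?splitr // lt0r_neq0 ?implybT.
have lnv : e / 2 * ln (N%:R : R) <= v by rewrite -ln_powR; exact/ltW/ln_sublinear.
have cv : c * (2 / e) <= v by rewrite /v; near: N; exact: powR_nat_eventually_ge.
have -> : c * ln N%:R = (c * (2 / e)) * (e / 2 * ln (N%:R : R)).
  by field; exact: lt0r_neq0.
apply: (@le_trans _ _ ((c * (2 / e)) * v)); first by rewrite ler_wpM2l // mulr_ge0 // divr_ge0 // ltW.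
by rewrite ler_pM2r.
Unshelve. all: by end_near. Qed.

(** exp(1/2) is at most 2, because exp(-1/2) is at least 1 - 1/2. *)
Lemma exp_half_le (R : realType) (n : nat) : expR (n%:R / 2 : R) <= 2 ^+ n.
Proof.
rewrite expRM_natl; apply: lerXn2r; rewrite ?nnegrE ?expR_ge0 //.
rewrite -lef_pV2 ?posrE ?expR_gt0 // -expRN.
by apply: le_trans (expR_ge1Dx _); lra.
Qed.

Lemma add_halves_leq (m H K N : nat) :
  (2 * m <= N)%N -> (H * (4 * K) <= N)%N -> (m + 2 * H * K <= N)%N.
Proof. lia. Qed.

(** With u = N^(eta/8), take A = floor(u) + 1, block length A^2 and H = floor(N / (4 A^2)). The 2H
    blocks then fill at most N / 2 indices, leaving room for the offset [n1]. Since (1 + 1/u)^A is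
    at least 2, a block multiplies the sequence by at least 2^A, which beats every power of N. *)
Lemma block_parameters (R : realType) (eta : R) (n1 : nat) : 0 < eta -> eta <= 1 ->
  \forall N \near \oo, exists A H : nat,
  let delta := (N%:R : R) `^ (- (2 - eta)) in
  [/\ (0 < N)%N /\ (3 <= H)%N, (n1 + 2 * H * (A * A) <= N)%N,
      (N%:R : R) `^ (eta / 8) <= A%:R /\ H%:R * delta <= 2,
      4 * H.+1%:R / delta <= 2 ^+ A &
      expR (- (H%:R * (H%:R * delta / 4))) <= (N%:R ^+ 2)^-1 ].
Proof.
move=> eta0 eta1; have e0 : 0 < eta / 8 by rewrite divr_gt0.
near=> N.
have N0 : (0 < N)%N by near: N; exact: nbhs_infty_gt.
have N1 : 1 <= N%:R :> R by rewrite ler1n.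
have NR0 : 0 < N%:R :> R by rewrite ltr0n.
have Nn0 : N%:R != 0 :> R by rewrite lt0r_neq0.
have N3 : 3 <= N%:R :> R by near: N; exact: nbhs_infty_ger.
have Nn1 : (2 * n1 <= N)%N by near: N; exact: nbhs_infty_ge.
set u := (N%:R : R) `^ (eta / 8).
(* The final estimate needs u^3 to be at least 16^3 = 4 * 1024. *)
have u16 : 16 <= u by rewrite /u; near: N; exact: powR_nat_eventually_ge.
have uln : 10 * ln (N%:R : R) <= u by rewrite /u; near: N; exact: ln_nat_eventually_le.
have u8 : u ^+ 8 = (N%:R : R) `^ eta.
  by rewrite -powR_mulrn ?powR_ge0 // -powRrM; congr (_ `^ _); field.
have u8N : u ^+ 8 <= N%:R by rewrite u8 -[leRHS]powRr1 ?ler_powR // ltW.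
pose A := (Num.truncn u).+1.
have Au : u <= A%:R by exact/ltW/truncnS_gt.
have A2u : A%:R <= 2 * u.
  rewrite /A -natr1; have : (Num.truncn u)%:R <= u by rewrite truncn_le //; lra.
  lra.
pose H := (N %/ (4 * (A * A)))%N.
have HN : (H * (4 * (A * A)) <= N)%N by exact: leq_trunc_div.
have A0 : (0 < A)%N by [].
have NH : (N < H.+1 * (4 * (A * A)))%N by rewrite ltn_ceil // !muln_gt0 A0.
have u2 : 0 < u by lra.
have NHR : N%:R < H.+1%:R * (16 * u ^+ 2).
  have : (N%:R : R) < (H.+1 * (4 * (A * A)))%:R by rewrite ltr_nat.
  rewrite !natrM => h; apply: (lt_le_trans h); apply: ler_wpM2l => //.
  have := ler_pM (ler0n R A) (ler0n R A) A2u A2u; rewrite expr2; lra.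
have u256 : 256 <= u ^+ 2 by rewrite expr2; have := ler_pM (ler0n R 16) (ler0n R 16) u16 u16; lra.
have u4 : 256 <= u ^+ 4.
  rewrite (_ : u ^+ 4 = u ^+ 2 * u ^+ 2); last by rewrite -exprD.
  by apply: (le_trans u256); rewrite ler_peMl; lra.
have H4 : 4 <= H.+1%:R :> R.
  rewrite -(ler_pM2r (_ : 0 < 16 * u ^+ 2)); last by lra.
  apply: le_trans (ltW NHR); apply: le_trans u8N.
  rewrite (_ : u ^+ 8 = u ^+ 4 * u ^+ 2 * u ^+ 2); last by rewrite -!exprD.
  rewrite mulrA ler_pM2r; last by lra.
  apply: (@le_trans _ _ (u ^+ 4)); first by lra.
  by rewrite ler_peMr; lra.
have Hlow : N%:R <= H%:R * (32 * u ^+ 2).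
  apply: (le_trans (ltW NHR)); rewrite (_ : H%:R * (32 * u ^+ 2) = (2 * H%:R) * (16 * u ^+ 2)); last by ring.
  rewrite ler_pM2r; last by lra.
  rewrite -natr1 in H4 *; lra.
have HNn : (H <= N)%N by exact: leq_div.
exists A, H.
set delta := (N%:R : R) `^ (- (2 - eta)).
have d0 : 0 < delta by exact: powR_gt0.
have dE : delta * N%:R ^+ 2 = u ^+ 8.
  rewrite u8 -powR_mulrn ?ler0n // -powRD ?Nn0 ?implybT //; congr (_ `^ _); ring.
split => //.
- by split => //; rewrite -ltnS -(ler_nat R).
- exact: add_halves_leq.
- split => //.
  apply: (@le_trans _ _ (N%:R * delta)); first by rewrite ler_pM2r // ler_nat.
  rewrite -(ler_pM2r NR0) (_ : _ * _ * _ = delta * N%:R ^+ 2); last by ring.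
  by rewrite dE; apply: (le_trans u8N); lra.
(* 4 (H + 1) is at most 8 N, hence at most N^3, hence at most N^5 delta = N^3 u^8. Then N^5 = exp(5
   ln N) is at most exp(A / 2) by [uln]. *)
- apply: (@le_trans _ _ (N%:R ^+ 5)).
    rewrite ler_pdivrMr // (_ : 5 = 3 + 2)%N // exprD -mulrA [_ * delta]mulrC dE.
    have HN1 : H.+1%:R <= 2 * N%:R :> R.
      rewrite -natr1; have : H%:R <= N%:R :> R by rewrite ler_nat.
      lra.
    apply: (@le_trans _ _ (N%:R ^+ 3 * 1)); last first.
      by rewrite ler_pM2l ?exprn_gt0 // exprn_ege1 //; lra.
    rewrite mulr1; apply: (@le_trans _ _ (8 * N%:R)); first by lra.
    rewrite exprSr ler_pM2r // expr2.
    have := ler_pM (ler0n R 3) (ler0n R 3) N3 N3; lra.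
  apply: le_trans (exp_half_le R A).
  rewrite -[N%:R in leLHS](@lnK R) ?posrE // -expRM_natl ler_expR; lra.
- rewrite -[(_ ^+ 2)^-1](@lnK R) ?posrE ?invr_gt0 ?exprn_gt0 // ler_expR.
  rewrite lnV ?posrE ?exprn_gt0 // lnXn // lerN2.
  (* [Hlow] says that H is at least N / (32 u^2), and N^2 delta = u^8; so H^2 delta is at least u^4
     / 1024. *)
  have HH : u ^+ 4 <= 1024 * (H%:R * (H%:R * delta)).
    have N20 : 0 < N%:R ^+ 2 :> R by rewrite exprn_gt0.
    rewrite -(ler_pM2r N20).
    rewrite (_ : 1024 * (H%:R * (H%:R * delta)) * N%:R ^+ 2 = (H%:R * 32) ^+ 2 * u ^+ 4 * u ^+ 4); last first.
      by rewrite -[RHS]mulrA -exprD -[in RHS]dE; ring.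
    rewrite [leLHS]mulrC ler_pM2r; last by lra.
    rewrite (_ : (H%:R * 32) ^+ 2 * u ^+ 4 = (H%:R * (32 * u ^+ 2)) ^+ 2); last by ring.
    by apply: lerXn2r; rewrite ?nnegrE // (le_trans _ Hlow).
  have uu : 4 * (1024 * u) <= u ^+ 4.
    rewrite exprSr mulrA ler_pM2r // exprSr.
    have := ler_pM (ler0n R 256) (ler0n R 16) u256 u16; lra.
  rewrite mulr2n; lra.
Unshelve. all: by end_near. Qed.

(** * Measure of the separated set for one N *)

(** [mass_decay] with m = H is applied to y_i = x_(n1 + i K), K = A^2. Its error term 1 / y_H is at
    most 1 / x_(n1), a constant independent of N. *)
Lemma separated_set_mass (R : realType) (x : nat -> R) (eta : R) :
  (forall n : nat, (1 <= n)%N -> 0 < x n) ->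
  (forall eps : R, 0 < eps ->
     exists n0 : nat, forall n : nat, (n0 <= n)%N -> (1 <= n)%N ->
       (1 + (n%:R `^ eps)^-1) * x n < x n.+1) ->
  0 < eta -> eta <= 1 ->
  exists C : R, \forall N \near \oo, forall a b, a <= b ->
    mass (separated_set x N (N%:R `^ (- (2 - eta)))) a b <= (b - a + C) / N%:R ^+ 2.
Proof.
move=> xpos xgrowth eta0 eta1.
have [n0 g0] := xgrowth (eta / 8) (divr_gt0 eta0 (ltr0n _ 8)).
pose n1 := maxn n0 1.
exists (x n1)^-1.
near=> N.
have [A [H [[N0 H3] n1N [NA Hd] CA expH]]] :
  exists A H : nat,
  let delta := (N%:R : R) `^ (- (2 - eta)) in
  [/\ (0 < N)%N /\ (3 <= H)%N, (n1 + 2 * H * (A * A) <= N)%N,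
      (N%:R : R) `^ (eta / 8) <= A%:R /\ H%:R * delta <= 2,
      4 * H.+1%:R / delta <= 2 ^+ A &
      expR (- (H%:R * (H%:R * delta / 4))) <= (N%:R ^+ 2)^-1 ].
  by near: N; exact: block_parameters.
move=> a b ab.
set delta := (N%:R : R) `^ (- (2 - eta)) in Hd CA expH *.
have NR0 : 0 < N%:R :> R by rewrite ltr0n.
have d0 : 0 < delta by exact: powR_gt0.
pose r : R := 1 + (N%:R `^ (eta / 8))^-1.
have u0 : 0 < (N%:R : R) `^ (eta / 8) by exact: powR_gt0.
have r1 : 1 <= r by rewrite /r lerDl invr_ge0 ltW.
have r0 : 0 <= r by exact: le_trans r1.
have n1_1 : (1 <= n1)%N by rewrite leq_max orbT.
have n1_n0 : (n0 <= n1)%N by rewrite leq_max leqnn.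
(* For indices up to N the ratio bound at n is weakened to the uniform [r]. *)
have xr n : (n1 <= n)%N -> (n <= N)%N -> r * x n <= x n.+1.
  move=> n1n nN; have n1' := leq_trans n1_1 n1n.
  apply: le_trans (ltW (g0 n (leq_trans n1_n0 n1n) n1')).
  rewrite ler_pM2r ?xpos // lerD2l lef_pV2 ?posrE ?powR_gt0 ?ltr0n //.
  by apply: ge0_ler_powR; rewrite ?nnegrE ?ler_nat // ltW // divr_gt0.
pose K := (A * A)%N.
have A0 : (0 < A)%N by rewrite -(ltr0n R); exact: lt_le_trans NA.
have K0 : (0 < K)%N by rewrite muln_gt0 A0.
have rA : 2 <= r ^+ A.
  apply: (@le_trans _ _ (1 + A%:R * (N%:R `^ (eta / 8))^-1)).
    suff : 1 <= A%:R * ((N%:R : R) `^ (eta / 8))^-1 by lra.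
    by rewrite ler_pdivlMr // mul1r.
  (* Bernoulli's inequality. *)
  rewrite /r; elim: (A) => [|n IH]; first by rewrite mul0r addr0.
  rewrite exprS; set v := (_^-1) in IH *.
  have v0 : 0 <= v by rewrite invr_ge0 ltW.
  apply: (@le_trans _ _ ((1 + v) * (1 + n%:R * v))); last first.
    by rewrite ler_wpM2l // addr_ge0.
  have : 0 <= n%:R * (v * v) by rewrite !mulr_ge0.
  rewrite -natr1; lra.
have rK : 4 * H.+1%:R / delta <= r ^+ K.
  apply: (le_trans CA); rewrite exprM.
  by apply: lerXn2r; rewrite ?nnegrE ?exprn_ge0.
pose y i := x (n1 + i * K)%N.
have iN i : (i <= 2 * H)%N -> (n1 + i * K <= N)%N.
  by move=> iH; apply: leq_trans n1N; rewrite leq_add2l leq_mul2r iH orbT.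
have y0 i : (i <= 2 * H)%N -> 0 < y i.
  by move=> _; apply: xpos; exact: leq_trans (leq_addr _ _).
have yr i : (i < 2 * H)%N -> r ^+ K * y i <= y i.+1.
  move=> iH; have yS : (n1 + i.+1 * K = n1 + i * K + K)%N by rewrite mulSn addnCA addnC.
  rewrite /y yS; apply: geometric_growth => // n /andP[n_ge n_lt].
  apply: xr; first exact: leq_trans (leq_addr _ _) n_ge.
  by apply: leq_trans (iN i.+1 iH); rewrite yS ltnW.
have yg i : (i < 2 * H)%N -> 4 * H.+1%:R / delta * y i <= y i.+1.
  by move=> iH; apply: le_trans (yr i iH); rewrite ler_pM2r // y0 // ltnW.
have ymono i : (i <= 2 * H)%N -> y 0%N <= y i.
  elim: i => // i IH iH; apply: (le_trans (IH (ltnW iH))); apply: le_trans (yr i iH).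
  by rewrite ler_peMl ?exprn_ege1 // ltW // y0 // ltnW.
have sep t : separated_set x N delta t -> forall i j, (i < 2 * H)%N -> (j < 2 * H)%N ->
    i != j -> forall z : int, delta <= `|t * (y j - y i) - z%:~R|.
  move=> st i j iH jH ij z; apply: st.
  - by rewrite iN ?(ltnW jH) // andbT; exact: leq_trans (leq_addr _ _).
  - by rewrite iN ?(ltnW iH) // andbT; exact: leq_trans (leq_addr _ _).
  - by rewrite eqn_add2l eqn_pmul2r // eq_sym.
apply: (le_trans (@mass_decay R _ H y delta (measurable_separated_set _ _ _ _) H3 d0 Hd y0 yg sep H (leqnn _) a b ab)).
have HH : (H <= 2 * H)%N by rewrite mul2n -addnn leq_addr.
have -> : (2 * H - H)%N = H by rewrite mul2n -addnn addnK.
rewrite [leRHS]mulrC; apply: ler_pM.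
- by rewrite exprn_ge0 //; lra.
- by rewrite addr_ge0 ?subr_ge0 // invr_ge0 ltW // y0.
(* 1 - w is at most exp(-w), raised to the power H. *)
- apply: le_trans expH; rewrite -[X in expR X]mulrN expRM_natl; apply: lerXn2r; rewrite ?nnegrE ?expR_ge0 //.
    by lra.
  exact: expR_ge1Dx.
- rewrite lerD2l lef_pV2 ?posrE; [|exact: y0|exact: xpos].
  by have := ymono H HH; rewrite {1}/y mul0n addn0.
Unshelve. all: by end_near. Qed.

(** * Borel-Cantelli and the almost-everywhere bound for fixed eta *)

Lemma borel_cantelli_itv (R : realType) (F : nat -> set R) (a b C : R) :
  (forall N, measurable (F N)) -> a <= b ->
  (\forall N \near \oo, mass (F N) a b <= C / N%:R ^+ 2) ->
  (@lebesgue_measure R).-negligible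
    [set t | a <= t < b /\ forall N0, exists2 N, (N0 <= N)%N & F N t].
Proof.
move=> mF ab [N1 _ bnd].
(* The shift passes the threshold [N1] and makes 1 / (N + N1 + 2)^2 at most 1 / ((N + 1)(N + 2)),
   which telescopes. *)
pose G N := F (N + N1.+2)%N `&` `[a, b[.
have mG N : measurable (G N) by exact: measurableI.
(* The sign of [C] is read off the bound at the positive index N1 + 1. *)
have C0 : 0 <= C.
  have N1S : (N1 <= N1.+1)%N by [].
  have m0 : 0 <= mass (F N1.+1) a b by exact: fine_ge0.
  have := le_trans m0 (bnd N1.+1 N1S).
  by rewrite pmulr_lge0 // invr_gt0 exprn_gt0.
have G0 : lebesgue_measure (lim_sup_set G) = 0%E.
  apply: lim_sup_set_cvg0 => //.
  apply: (@le_lt_trans _ _ C%:E); last exact: ltry.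
  apply: lime_le; first by apply: is_cvg_nneseries => n _ _; exact: measure_ge0.
  apply: nearW => n.
  apply: (@le_trans _ _ (C * (1 - (n.+1%:R)^-1))%:E); last first.
    by rewrite lee_fin ler_piMr // gerBl invr_ge0.
  elim: n => [|n IH]; first by rewrite big_geq // invr1 subrr mulr0.
  rewrite big_nat_recr //=.
  apply: (@le_trans _ _ ((C * (1 - n.+1%:R^-1))%:E + (C * (n.+1%:R^-1 - n.+2%:R^-1))%:E)%E); last first.
    by rewrite -EFinD lee_fin -mulrDr ler_wpM2l // addrA subrK.
  apply: leeD => //; rewrite /G -mass_fineK // lee_fin.
  apply: (le_trans (bnd _ _)); first exact: (leq_trans (leqW (leqnSn N1)) (leq_addl n _)).
  apply: ler_wpM2l => //.
  have n1 : 0 < n.+1%:R :> R by rewrite ltr0n.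
  have n2 : 0 < n.+2%:R :> R by rewrite ltr0n.
  have -> : n.+1%:R^-1 - n.+2%:R^-1 = (n.+1%:R * n.+2%:R)^-1 :> R.
    rewrite -[n.+2%:R]natr1; move: (n.+1%:R) n1 => v v0.
    by field; rewrite !lt0r_neq0 ?addr_gt0.
  have nN : (n.+2 <= n + N1.+2)%N by rewrite !addnS !ltnS leq_addr.
  rewrite lef_pV2 ?posrE ?exprn_gt0 ?mulr_gt0 ?ltr0n ?(leq_trans _ nN) //.
  by rewrite -natrM -natrX ler_nat -mulnn leq_mul // ltnW.
exists (lim_sup_set G); split => //.
  apply: bigcap_measurableType => n _; apply: bigcup_measurable => k _; exact: mG.
move=> t [tab tF] n _.
have [N nN FN] := tF (n + N1.+2)%N.
exists (N - N1.+2)%N; first by rewrite /= leq_subRL ?(leq_trans (leq_addl _ _) nN) // addnC.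
by rewrite /G subnK ?(leq_trans (leq_addl _ _) nN).
Qed.

(** The line is exhausted by the intervals [-k, k[; on each, the alpha separated for infinitely many
    N form a null set. *)
Lemma ae_delta_min_lt (R : realType) (x : nat -> R) (eta : R) :
  (forall n : nat, (1 <= n)%N -> 0 < x n) ->
  (forall eps : R, 0 < eps ->
     exists n0 : nat, forall n : nat, (n0 <= n)%N -> (1 <= n)%N ->
       (1 + (n%:R `^ eps)^-1) * x n < x n.+1) ->
  0 < eta -> eta <= 1 ->
  {ae (@lebesgue_measure R), forall alpha : R, exists N0 : nat,
    forall N, (N0 <= N)%N -> delta_min x alpha N < N%:R `^ (- (2 - eta))}.
Proof.
move=> xpos xgrowth eta0 eta1.
have [C HC] := separated_set_mass R x eta xpos xgrowth eta0 eta1.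
pose F N := separated_set x N ((N%:R : R) `^ (- (2 - eta))).
pose B (k : nat) := [set t : R | - k%:R <= t < k%:R /\
  forall N0, exists2 N, (N0 <= N)%N & F N t].
apply: (@negligibleS _ _ _ (@lebesgue_measure R) (\bigcup_k B k)); last first.
  apply: negligible_bigcup => k.
  have kk : - k%:R <= k%:R :> R by have := ler0n R k; lra.
  apply: (@borel_cantelli_itv R F (- k%:R) k%:R (k%:R - - k%:R + C)) => //.
    by move=> N; exact: measurable_separated_set.
  by apply: filterS HC => N; apply.
move=> t /= noN0; exists (Num.truncn `|t|).+1 => //.
split.
  have := truncnS_gt `|t|; rewrite ltr_norml => /andP[t1 t2].
  by rewrite t2 andbT ltW.
move=> N0; apply: contrapT => noN; apply: noN0; exists N0 => N N0N.
by apply: delta_min_lt => Ft; apply: noN; exists N.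
Qed.

(** * Diagonal choice of the o(1) term *)

(** f(N) is the infimum of the exponents 1 / (q + 1) admissible at N, plus 1 / (N + 1). Each
    exponent is eventually admissible, so f tends to 0; the added term guarantees an admissible
    exponent below f(N). *)
Lemma diagonal_exponent (R : realType) (d : nat -> R) :
  (forall q : nat, exists N0 : nat, forall N, (N0 <= N)%N ->
     d N < N%:R `^ (- (2 - q.+1%:R^-1))) ->
  exists f : nat -> R, f @ \oo --> (0 : R) /\
    exists N0 : nat, forall N : nat, (N0 <= N)%N -> d N < N%:R `^ (- (2 - f N)).
Proof.
move=> Hd.
pose S N := [set r : R | exists2 q : nat, r = q.+1%:R^-1 & d N < N%:R `^ (- (2 - q.+1%:R^-1))].
have lbS N : has_lbound (S N) by exists 0 => _ [q -> _].
have S0 q : \forall N \near \oo, S N q.+1%:R^-1.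
  by have [N0 HN0] := Hd q; exists N0 => // N N0N; exists q => //; exact: HN0.
exists (fun N => inf (S N) + N.+1%:R^-1); split.
  rewrite -[0 in X in _ --> X]addr0; apply: cvgD; last exact: cvg_harmonic.
  apply/cvgrPdist_le => e e0.
  have [q qe] : exists q : nat, (q.+1%:R^-1 : R) <= e.
    exists (Num.truncn e^-1); rewrite -[leRHS]invrK lef_pV2 ?posrE ?invr_gt0 //.
    exact/ltW/truncnS_gt.
  near=> N; have SN : S N q.+1%:R^-1 by near: N; exact: S0.
  rewrite sub0r normrN ger0_norm; last first.
    by apply: lb_le_inf; [exists q.+1%:R^-1|move=> _ [p -> _]].
  by apply: le_trans qe; exact: ge_inf.
(* q = 0 makes [S N] nonempty from [N0] on; N at least 1 makes N^s monotone in s. *)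
have [N0 HN0] := Hd 0%N; exists (maxn N0 1) => N; rewrite geq_max => /andP[N0N N1].
have SN : S N !=set0 by exists 1%:R^-1, 0%N => //; exact: HN0.
have ltinf : inf (S N) < inf (S N) + N.+1%:R^-1 by rewrite ltrDl invr_gt0.
have [_ [q -> dq] qlt] := inf_lt SN ltinf.
apply: (lt_le_trans dq); apply: ler_powR; first by rewrite ler1n.
by rewrite lerN2 lerD2l lerN2 ltW.
Unshelve. all: by end_near. Qed.

(* The sequence is x 1, x 2, ... ; the value x 0 is irrelevant. *)
Theorem theorem5 (R : realType) (x : nat -> R)
  (xpos : forall n : nat, (1 <= n)%N -> 0 < x n)
  (xgrowth : forall eps : R, 0 < eps ->
     exists n0 : nat, forall n : nat, (n0 <= n)%N -> (1 <= n)%N ->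
       (1 + (n%:R `^ eps)^-1) * x n < x n.+1) :
  {ae (@lebesgue_measure R), forall alpha : R,
     exists f : nat -> R, f @ \oo --> (0 : R) /\
       exists N0 : nat, forall N : nat, (N0 <= N)%N ->
         delta_min x alpha N < N%:R `^ (- (2 - f N))}.
Proof.
have ae_q (q : nat) : {ae (@lebesgue_measure R), forall alpha : R, exists N0 : nat,
    forall N, (N0 <= N)%N -> delta_min x alpha N < N%:R `^ (- (2 - q.+1%:R^-1))}.
  by apply: ae_delta_min_lt; rewrite // ?invr_gt0 ?invf_le1 ?ltr0n ?ler1n.
(* Countably many null sets, one for each q, are discarded together. *)
apply: filterS (ae_foralln ae_q) => alpha; exact: diagonal_exponent.
Qed.
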